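(* For $m\ge 4$, call $\mathbf{x}=(x_1,\ldots,x_m)\in\mathbb{R}^m$ generic if the $\binom{m}{2}$ midpoints $(x_i+x_j)/2$, $1\le i<j\le m$, are pairwise distinct, and define its ranking pattern $$\mathrm{RP}^{\mathrm{UF}}(\mathbf{x})=\{(i_1\cdots i_m)\in\mathbb{P}_m:\ |y-x_{i_1}|<\cdots<|y-x_{i_m}|\text{ for some }y\in\mathbb{R}\},$$ where $\mathbb{P}_m$ is the set of permutations $(i_1\cdots i_m)$ of $\{1,\ldots,m\}$. Let $r_0(m)$ be the number of distinct ranking patterns $\mathrm{RP}^{\mathrm{UF}}(\mathbf{x})$ with $\mathbf{x}$ generic and $x_1<x_2<\cdots<x_m$. Then for all $m\ge 4$, $$2\left(\frac{3}{4}\right)^{m-4}\bigl\{(m-3)!\bigr\}^2\ \le\ r_0(m)\ <\ \frac{2}{m!}\left\{\frac{e\,m(m-1)^2}{8}\right\}^{m-2}.$$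
   Context: Here $e$ is Euler's number. *)

(* Defs.v *)
From mathcomp Require Import all_boot all_fingroup.
From mathcomp Require Import boolp.
From Stdlib Require Import Reals.
Set Implicit Arguments. Unset Strict Implicit. Unset Printing Implicit Defensive.

Definition generic (m : nat) (x : 'I_m -> R) : Prop :=
  forall i j k l : 'I_m, (i < j)%N -> (k < l)%N -> (i, j) <> (k, l) ->
    ((x i + x j) / 2 <> (x k + x l) / 2)%R.

Definition strictly_increasing (m : nat) (x : 'I_m -> R) : Prop :=
  forall i j : 'I_m, (i < j)%N -> (x i < x j)%R.

(* s in 'S_m encodes (i_1 ... i_m) with i_{k+1} = s k.  The pattern s is
   realized at y when |y - x_{i_1}| < ... < |y - x_{i_m}|. *)
Definition realized_at (m : nat) (x : 'I_m -> R) (s : 'S_m) (y : R) : Prop :=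
  forall k k' : 'I_m, nat_of_ord k' = (nat_of_ord k).+1 ->
    (Rabs (y - x (s k)) < Rabs (y - x (s k')))%R.

Definition RP_UF (m : nat) (x : 'I_m -> R) : {set 'S_m} :=
  [set s : 'S_m | `[< exists y : R, realized_at x s y >] ].

Definition is_RP0 (m : nat) (S : {set 'S_m}) : Prop :=
  exists x : 'I_m -> R, generic x /\ strictly_increasing x /\ RP_UF x = S.

Definition r0 (m : nat) : nat := #| [set S : {set 'S_m} | `[< is_RP0 S >] ] |.

(* Main.v *)
(* A ranking pattern records exactly the left-to-right order of the midpoints, so
   r_0(m) counts the regions into which the hyperplanes x_i + x_j = x_k + x_l
   divide the cone x_1 < ... < x_m.

   Upper bound: permuting coordinates, m! r_0(m) is at most the number of sign
   vectors of the forms x_j - x_i and x_k + x_l - x_i - x_j at points where none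
   vanishes.  These forms all lie in a space of dimension m - 1.  Once the sign of one
   of them is prescribed, a set of the others whose signs are arbitrary has at
   most m - 2 elements, since a linear dependency would forbid a sign vector.
   With N other forms, Pajor's inequality gives at most sum_(i <= m-2) C(N, i)
   sign vectors, which is then bounded by the usual exponential estimate.

   Lower bound: given x_1 < ... < x_m, a new point t > x_m changes pattern whenever
   it crosses a wall x_k + x_l - x_j > x_m with j < k < l.  Let W(x) be the
   number of walls.  The triples with l = m always give walls, and for
   1 < k < l < m either (1, k, l) is a wall of x or the mirror image triple is a wall
   of the reflected configuration -x, whence
   W(x) + W(-x) >= (m-1)(m-2) + C(m-2, 2) >= 3/2 (m-2)^2.  Summing over all patterns,
   r_0(m+1) >= 3/4 (m-2)^2 r_0(m). *)

Require Import Defs.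
From mathcomp Require Import all_boot all_order all_algebra all_fingroup.
From mathcomp Require Import boolp Rstruct zify.
From Stdlib Require Import Reals Lra.
Delimit Scope ring_scope with ring.
Set Implicit Arguments. Unset Strict Implicit. Unset Printing Implicit Defensive.

(** * Pajor's inequality *)

Section Pajor.
Variable T : finType.
Implicit Types (F : {set {set T}}) (Y Z : {set T}).

Definition shatters F Y :=
  [forall Z : {set T}, (Z \subset Y) ==> [exists A in F, A :&: Y == Z]].

Lemma shattersP F Y :
  reflect (forall Z, Z \subset Y -> exists2 A, A \in F & A :&: Y = Z) (shatters F Y).
Proof.
apply: (iffP forallP) => [h Z ZY | h Z].
  by move: (h Z); rewrite ZY /= => /exists_inP[A AF /eqP e]; exists A.
apply/implyP => /h[A AF e]; apply/exists_inP; exists A => //; exact/eqP.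
Qed.

Lemma shatters_sub F F' Y : F \subset F' -> shatters F Y -> shatters F' Y.
Proof.
move=> sF /shattersP h; apply/shattersP => Z /h[A AF e]; exists A => //.
exact: (subsetP sF).
Qed.

(* Splitting on a point x separating two members of F: no set shattered by one
   half contains x, and a set Y shattered by both halves yields both Y and x |: Y. *)
Lemma card_le_shattered F : #|F| <= #|[set Y | shatters F Y]|.
Proof.
have [n] := ubnP #|F|; elim: n F => // n IH F /ltnSE leFn.
have [F1|F1] := leqP #|F| 1.
  have [->|[A AF]] := set_0Vmem F; first by rewrite cards0.
  apply: (leq_trans F1); rewrite card_gt0; apply/set0Pn; exists set0.
  rewrite inE; apply/shattersP => Z; rewrite subset0 => /eqP ->.
  by exists A => //; rewrite setI0.
(* Two distinct members cannot include each other; a point of [A] outside [B] makes both halves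
   nonempty, hence each is smaller than [F] and the induction applies. *)
have [A [B [AF BF nAB]]] : exists A B, [/\ A \in F, B \in F & ~~ (A \subset B)].
  have /card_gt1P[A [B [AF BF]]] := F1.
  rewrite eqEsubset negb_and => /orP[h|h]; first by exists A, B.
  by exists B, A.
have /subsetPn[x xA xB] := nAB.
pose F1' := [set C in F | x \in C]; pose F0 := [set C in F | x \notin C].
have eF : #|F| = #|F1'| + #|F0|.
  rewrite -(cardsID [set C : {set T} | x \in C] F); congr (_ + _); apply: eq_card => C;
    by rewrite !inE // andbC.
have p1 : 0 < #|F1'| by rewrite card_gt0; apply/set0Pn; exists A; rewrite !inE AF.
have p0 : 0 < #|F0| by rewrite card_gt0; apply/set0Pn; exists B; rewrite !inE BF.
have h1 := IH F1' ltac:(lia); have h0 := IH F0 ltac:(lia).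
set S1 := [set Y | shatters F1' Y] in h1; set S0 := [set Y | shatters F0 Y] in h0.
have x1 Y : Y \in S1 -> x \notin Y.
  rewrite inE => /shattersP /(_ set0 (sub0set _))[C]; rewrite inE => /andP[_ xC] e.
  by apply/negP => xY; have := in_set0 x; rewrite -e inE xC xY.
have x0 Y : Y \in S0 -> x \notin Y.
  rewrite inE => /shattersP /(_ Y (subxx _))[C]; rewrite inE => /andP[_ xC] e.
  by apply/negP => xY; move: (xY); rewrite -e inE (negbTE xC).
have inj : {in S1 :&: S0 &, injective (fun Y => x |: Y)}.
  move=> Y Z /setIP[/x1 Y1 _] /setIP[/x1 Z1 _] e.
  by rewrite -(setU1K Y1) e setU1K.
have sub : (S1 :|: S0) :|: [set x |: Y | Y in S1 :&: S0] \subset [set Y | shatters F Y].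
  apply/subsetP => Y; case/setUP=> [/setUP[]|].
  - by rewrite !inE; apply: shatters_sub; apply/subsetP => C; rewrite inE => /andP[].
  - by rewrite !inE; apply: shatters_sub; apply/subsetP => C; rewrite inE => /andP[].
  case/imsetP => Z /setIP[Z1 Z0] ->.
  have xZ := x1 _ Z1.
  move: Z1 Z0; rewrite !inE => /shattersP Z1 /shattersP Z0.
  apply/shattersP => V sV.
  have sVx : V :\ x \subset Z by rewrite subDset setUC setUC.
  (* Both halves shatter [Z]; the one to search is dictated by whether [V] contains [x]. *)
  have [xV|xV] := boolP (x \in V).
    have [C] := Z1 _ sVx; rewrite inE => /andP[CF xC] e; exists C => //.
    by rewrite setIUr e; apply/setP => y; rewrite !inE; case: (eqVneq y x) => [->|] //=;
      rewrite ?xC ?xV ?andbF.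
  have [C] := Z0 _ sVx; rewrite inE => /andP[CF xC] e; exists C => //.
  by rewrite setIUr e; apply/setP => y; rewrite !inE; case: (eqVneq y x) => [->|] //=;
    rewrite ?(negbTE xC) ?(negbTE xV) ?andbF.
apply: leq_trans (subset_leq_card sub).
have dis : (S1 :|: S0) :&: [set x |: Y | Y in S1 :&: S0] = set0.
  apply/setP => Y; rewrite in_set0; apply/negbTE/negP => /setIP[h /imsetP[Z _ eY]].
  have : x \in Y by rewrite eY !inE eqxx.
  by apply/negP; case/setUP: h => h; [apply: x1|apply: x0].
rewrite cardsU dis cards0 subn0 card_in_imset //.
by have := cardsUI S1 S0; lia.
Qed.

(** A shattered set is the trace of a member of [F], so it lies inside [X]; sorting such subsets by
    size gives the binomial sum. *)
Lemma card_le_shattered_draws F (X : {set T}) k :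
  {in F, forall A : {set T}, A \subset X} ->
  (forall Y, shatters F Y -> #|Y| <= k) ->
  #|F| <= \sum_(i < k.+1) 'C(#|X|, i).
Proof.
move=> FX hk; apply: (leq_trans (card_le_shattered F)).
rewrite (eq_bigr (fun i : 'I_k.+1 => #|[set B : {set T} | B \subset X & #|B| == i]|)); last first.
  by move=> i _; rewrite cards_draws.
pose B (i : 'I_k.+1) := [set B : {set T} | B \subset X & #|B| == i].
apply: (@leq_trans #|\bigcup_i B i|); last first.
  elim/big_rec2: _ => [|i n C _ le]; first by rewrite cards0.
  by apply: leq_trans (leq_card_setU _ _) _; rewrite leq_add2l.
apply/subset_leq_card/subsetP => Y; rewrite inE => sY.
have /shattersP/(_ Y (subxx _))[A AF e] := sY.
apply/bigcupP; exists (Ordinal (hk _ sY : #|Y| < k.+1)) => //.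
by rewrite inE eqxx -{1}e (subset_trans (subsetIl _ _) (FX _ AF)).
Qed.
End Pajor.

(** * Sign vectors of linear forms *)

Section ConeSigns.
Import Order.TTheory GRing.Theory Num.Theory.
Local Open Scope ring_scope.
Variable F : realFieldType.
Variables (d : nat) (T : finType) (v0 : 'rV[F]_d) (v : T -> 'rV[F]_d).

(* A linear dependency among v0 and the v t, t in Y, with coefficient of v0
   nonnegative, excludes the sign vector given by its own coefficients. *)
Lemma cone_signs_card (Y : {set T}) :
  (v0 *m const_mx 1 = 0 :> 'M_1) ->
  (forall t, t \in Y -> v t *m const_mx 1 = 0 :> 'M_1) ->
  (forall Z : {set T}, Z \subset Y -> exists x : 'cV[F]_d, 0 < (v0 *m x) 0 0 /\
     forall t, t \in Y -> if t \in Z then 0 < (v t *m x) 0 0 else (v t *m x) 0 0 < 0) ->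
  (#|Y|.+1 < d)%nat.
Proof.
move=> s0 s h; rewrite ltnNge; apply/negP => dY.
pose W : 'M[F]_(1 + #|Y|, d) := col_mx v0 (\matrix_(i < #|Y|) v (enum_val i)).
have [d0|d0] := posnP d.
  have [x [+ _]] := h _ (sub0set _).
  rewrite mxE big1 ?ltxx // => i _; exfalso.
  by have := ltn_ord i; rewrite [X in (_ < X)%nat]d0.
have W1 : W *m const_mx 1 = 0 :> 'cV_(1 + #|Y|).
  rewrite mul_col_mx s0 [X in col_mx _ X](_ : _ = 0) ?col_mx0 //; apply/colP => j.
  have /matrixP/(_ 0 0) := s _ (enum_valP j); rewrite !mxE => e; apply: etrans e.
  by apply: eq_bigr => k _; rewrite !mxE.
(* If [d <= 1 + #|Y|], independent rows would give [W] full column rank, although it kills the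
   nonzero all-ones vector. *)
have nfree : ~~ row_free W.
  apply/negP => fr.
  have rk : row_full W.
    by rewrite /row_full eqn_leq rank_leq_col (eqP (fr : \rank W == _)).
  have /matrixP/(_ (Ordinal d0) 0) : const_mx 1 = 0 :> 'cV[F]_d.
    by rewrite -[LHS]mul1mx; have/row_fullP[B <-] := rk; rewrite -mulmxA W1 mulmx0.
  by rewrite !mxE => /eqP; rewrite oner_eq0.
have [c c0 cW] : exists2 c : 'rV[F]_(1 + #|Y|), c != 0 & c *m W = 0.
  move: nfree; rewrite -kermx_eq0 => /rowV0Pn[c ck c0]; exists c => //.
  exact/sub_kermxP.
wlog c00 : c c0 cW / 0 <= c 0 0.
  move=> H; have [/H|] := leP 0 (c 0 0); first exact.
  by move=> cn; apply: (H (- c)); rewrite ?oppr_eq0 ?mulNmx ?cW ?oppr0 // mxE oppr_ge0 ltW.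
pose cc i := c 0 (rshift 1 i : 'I_(1 + #|Y|)).
(* With this choice every term of the dependency evaluated at [x] is nonnegative and vanishes only
   with its coefficient; as the sum is zero, so is [c]. *)
pose Z := [set enum_val i | i : 'I_#|Y| & 0 < cc i].
have ZY : Z \subset Y by apply/subsetP => t /imsetP[i _ ->]; exact: enum_valP.
have [x [x0 xY]] := h Z ZY.
have e : c 0 0 * (v0 *m x) 0 0 + \sum_i cc i * (v (enum_val i) *m x) 0 0 = 0.
  have : (c *m W *m x) 0 0 = 0 by rewrite cW mul0mx mxE.
  rewrite -mulmxA mul_col_mx mxE big_split_ord big_ord1 /= => e.
  apply: etrans e; congr (_ + _); first by rewrite col_mxEu; congr (c _ _ * _); apply/val_inj.
  apply: eq_bigr => i _; rewrite col_mxEd /cc; congr (_ * _).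
  by rewrite !mxE; apply: eq_bigr => k _; rewrite !mxE.
have pos i : 0 <= cc i * (v (enum_val i) *m x) 0 0 ?= iff (cc i == 0).
  have := xY _ (enum_valP i); have -> : (enum_val i \in Z) = (0 < cc i).
    apply/imsetP/idP => [[j] |ci]; last by exists i; rewrite // inE.
    by rewrite inE => + /enum_val_inj ->.
  case: ifPn => [cp vp|].
    split; first by rewrite mulr_ge0 // ltW.
    by rewrite eq_sym mulf_eq0 (gt_eqF vp) orbF.
  rewrite -leNgt => cn vn; split; first by rewrite mulr_le0 // ltW.
  by rewrite eq_sym mulf_eq0 (lt_eqF vn) orbF.
have sp : 0 <= \sum_i cc i * (v (enum_val i) *m x) 0 0 by apply: sumr_ge0 => i _; case: (pos i).
have fp : 0 <= c 0 0 * (v0 *m x) 0 0 by rewrite mulr_ge0 // ltW.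
move/eqP: e; rewrite paddr_eq0 // mulf_eq0 (gt_eqF x0) orbF => /andP[/eqP e0].
rewrite psumr_eq0 => [/allP e1|i _]; last by case: (pos i).
case/eqP: c0; apply/rowP => i; rewrite mxE.
case: (split_ordP i) => j ->.
  by rewrite -[RHS]e0; congr (c _ _); apply/val_inj; case: j => [[]].
have := e1 j (mem_index_enum _); rewrite eq_sym => e; apply/eqP.
by rewrite -[_ == 0](pos j).2.
Qed.
End ConeSigns.

(** * Ranking patterns and the order of midpoints *)

Definition near0 (P : R -> Prop) : Prop :=
  exists2 d, (0 < d)%R & forall e, (0 < e < d)%R -> P e.

Lemma near0_ex P : near0 P -> exists2 e, (0 < e)%R & P e.
Proof. by case=> d d0 h; exists (d / 2)%R; [lra | apply: h; lra]. Qed.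

Lemma near0_all (I : finType) (P : I -> R -> Prop) :
  (forall i, near0 (P i)) -> near0 (fun e => forall i, P i e).
Proof.
move=> h; have [d d0 hd] : near0 (fun e => forall i, i \in enum I -> P i e).
  elim: (enum I) => [|i s [d d0 hd]]; first by exists 1%R => //; lra.
  have [d' d'0 hd'] := h i; exists (Rmin d d') => [|e [e0 ed] j].
    exact: Rmin_glb_lt.
  have [ed1 ed2] := (Rmin_l d d', Rmin_r d d').
  rewrite inE => /orP[/eqP ->|js]; first by apply: hd'; lra.
  by apply: hd => //; lra.
by exists d => // e /hd he i; apply: he; rewrite mem_enum.
Qed.

Lemma near0_and P Q : near0 P -> near0 Q -> near0 (fun e => P e /\ Q e).
Proof.
move=> hP hQ; have [|d d0 h] := @near0_all bool (fun b => if b then P else Q); first by case.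
by exists d => // e /h he; split; [apply: (he true)|apply: (he false)].
Qed.

Lemma near0_imp (b : Prop) P : (b -> near0 P) -> near0 (fun e => b -> P e).
Proof.
case: (pselect b) => [hb /(_ hb)|nb _]; first by case=> d d0 h; exists d => // e /h.
by exists 1%R => [|e _ /nb //]; lra.
Qed.

Lemma near0_pos a b : (0 < a)%R -> near0 (fun e => 0 < a + e * b)%R.
Proof.
move=> a0; have b1 : (0 < Rabs b + 1)%R by have := Rabs_pos b; lra.
exists (a / (Rabs b + 1))%R => [|e [e0 ed]]; first exact: Rdiv_lt_0_compat.
have h : (e * (Rabs b + 1) < a)%R.
  by have := Rmult_lt_compat_r _ _ _ b1 ed; rewrite /Rdiv Rmult_assoc Rinv_l; lra.
have [h1|h1] := Rle_dec 0 b; first by nra.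
by move: h; rewrite Rabs_left; nra.
Qed.

Lemma near0_neq a b : a <> 0%R \/ b <> 0%R -> near0 (fun e => a + e * b <> 0)%R.
Proof.
move=> h; case: (total_order_T a 0) => [[a0|a0]|a0].
- have [|d d0 hd] := @near0_pos (- a) (- b); first by lra.
  by exists d => // e /hd; lra.
- exists 1%R => [|e e01]; first by lra.
  by case: h => // b0; rewrite a0 Rplus_0_l => /Rmult_integral[]; lra.
- have [d d0 hd] := @near0_pos a b a0.
  by exists d => // e /hd; lra.
Qed.

(** Used to place an observer between two finite families of midpoints, either of which may be
    empty; hence the initial bound [l0] below all values. *)
Lemma exists_between (I : finType) (f : I -> R) (P Q : pred I) :
  (forall i j, P i -> Q j -> (f i < f j)%R) ->
  exists y, (forall i, P i -> (f i < y)%R) /\ (forall j, Q j -> (y < f j)%R).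
Proof.
move=> PQ.
have [l0 hl0] : exists l, forall j, j \in enum I -> (l < f j)%R.
  elim: (enum I) => [|i s [l hl]]; first by exists 0%R.
  exists (Rmin l (f i - 1))%R => j; have := Rmin_l l (f i - 1); have := Rmin_r l (f i - 1).
  rewrite inE => h1 h2 /orP[/eqP ->|/hl]; lra.
have [l [lP lQ]] : exists l, (forall i, i \in enum I -> P i -> (f i <= l)%R) /\
    (forall j, Q j -> (l < f j)%R).
  elim: (enum I) => [|i s [l [lP lQ]]].
    by exists l0; split=> // j _; apply: hl0; rewrite mem_enum.
  have [Pi|nPi] := boolP (P i); last first.
    by exists l; split=> // j; rewrite inE => /orP[/eqP ->|/lP //]; rewrite (negbTE nPi).
  exists (Rmax l (f i)); split=> j; last by move=> Qj; apply: Rmax_lub_lt; [exact: lQ|exact: PQ].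
  have := Rmax_l l (f i); have := Rmax_r l (f i).
  by rewrite inE => h1 h2 /orP[/eqP ->|/lP h /h]; lra.
have [e e0 he] : exists2 e, (0 < e)%R & forall j, Q j -> (l + e < f j)%R.
  apply: near0_ex; apply: near0_all => j; apply: near0_imp => Qj.
  have [|d d0 hd] := @near0_pos (f j - l) (-1); first by have := lQ _ Qj; lra.
  by exists d => // e /hd; lra.
exists (l + e)%R; split=> // i Pi; have := lP i _ Pi; rewrite mem_enum => /(_ isT); lra.
Qed.

(** Indexing by naturals lets configurations be extended and reflected without casts between
    ordinals; midpoints are replaced by sums. *)
Definition generic_nat m (f : nat -> R) := forall i j k l, (i < j < m)%nat -> (k < l < m)%nat ->
  (i, j) <> (k, l) -> (f i + f j <> f k + f l)%R.

Definition increasing_nat m (f : nat -> R) := forall i j, (i < j < m)%nat -> (f i < f j)%R.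

(** One implication suffices to encode equality of the midpoint orders: genericity supplies the
    converse in [same_order_sym]. *)
Definition same_order m (f g : nat -> R) := forall i j k l, (i < j < m)%nat -> (k < l < m)%nat ->
  (f i + f j < f k + f l)%R -> (g i + g j < g k + g l)%R.

Definition RP_nat m (f : nat -> R) : {set 'S_m} := RP_UF (fun i : 'I_m => f i).

Lemma is_RP0_nat m S :
  is_RP0 S <-> exists f, [/\ generic_nat m f, increasing_nat m f & RP_nat m f = S].
Proof.
split=> [[x [gx [ix <-]]]|[f [gf ifx <-]]].
  (* The default 0 is harmless, since only indices below [m] are ever compared. *)
  pose f n := if insub n is Some i then x i else 0%R.
  have fx (i : 'I_m) : f i = x i by rewrite /f insubT // => h; congr x; exact: val_inj.
  exists f; split.
  - move=> i j k l /andP[ij jm] /andP[kl lm].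
    have im := ltn_trans ij jm; have km := ltn_trans kl lm => ne.
    have := @gx (Ordinal im) (Ordinal jm) (Ordinal km) (Ordinal lm) ij kl.
    rewrite -!fx /= => h e; apply: h; last by rewrite e.
    by case=> e1 e2; apply: ne; rewrite e1 e2.
  - move=> i j /andP[ij jm]; have im := ltn_trans ij jm.
    by have := @ix (Ordinal im) (Ordinal jm) ij; rewrite -!fx.
  - by rewrite /RP_nat (_ : (fun i : 'I_m => f i) = x) //; apply/funext.
exists (fun i : 'I_m => f i); split; last split=> //.
  move=> i j k l ij kl ne e; apply: (gf i j k l); rewrite ?ij ?kl ?ltn_ord //; last lra.
  by case=> e1 e2; apply: ne; congr pair; exact: val_inj.
by move=> i j ij; apply: ifx; rewrite ij ltn_ord.
Qed.

Lemma Rabs_lt_mid a b y : (a < b)%R -> (Rabs (y - a) < Rabs (y - b))%R <-> (y < (a + b) / 2)%R.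
Proof. by move=> ab; split; rewrite /Rabs; case: Rcase_abs; case: Rcase_abs; lra. Qed.
Lemma Rabs_gt_mid a b y : (a < b)%R -> (Rabs (y - b) < Rabs (y - a))%R <-> ((a + b) / 2 < y)%R.
Proof. by move=> ab; split; rewrite /Rabs; case: Rcase_abs; case: Rcase_abs; lra. Qed.

Lemma realized_atP m (x : 'I_m -> R) s y : realized_at x s y <->
  forall k k' : 'I_m, (k < k')%nat -> (Rabs (y - x (s k)) < Rabs (y - x (s k')))%R.
Proof.
split=> [h k k'|h k k' e]; last by apply: h; rewrite e.
have [n] := ubnP k'; case: k' => k' + /=.
elim: n k' => // n IH [//|k'] km kn; rewrite ltnS leq_eqVlt => /orP[/eqP e|lt].
  by apply: h; rewrite /= e.
apply: (Rlt_trans _ (Rabs (y - x (s (Ordinal (ltnW km)))))).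
  by apply: IH => //; lia.
exact: h.
Qed.

(** Being closer to the left one of two points means lying left of their midpoint, and [s^-1] gives
    the rank of a point in the pattern. *)
Lemma RP_natP m f (s : 'S_m) : increasing_nat m f ->
  s \in RP_nat m f <-> exists y, forall a b : 'I_m, (a < b)%nat ->
    if ((s^-1)%g a < (s^-1)%g b)%nat then (y < (f a + f b) / 2)%R else ((f a + f b) / 2 < y)%R.
Proof.
move=> fi; rewrite inE; split=> [/asboolP[y /realized_atP h]|[y h]].
  exists y => a b ab; have fab : (f a < f b)%R by apply: fi; rewrite ab ltn_ord.
  case: ltngtP => lt.
  - by apply/Rabs_lt_mid => //; have := h _ _ lt; rewrite !permKV.
  - by apply/Rabs_gt_mid => //; have := h _ _ lt; rewrite !permKV.
  - by move: ab; rewrite (perm_inj (val_inj lt)) ltnn.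
apply/asboolP; exists y; apply/realized_atP => k k' kk'.
have [lt|lt|/val_inj/perm_inj e] := ltngtP (s k) (s k'); last by rewrite e ltnn in kk'.
- have flt : (f (s k) < f (s k'))%R by apply: fi; rewrite lt ltn_ord.
  by apply/Rabs_lt_mid => //; have := h _ _ lt; rewrite !permK kk'.
- have flt : (f (s k') < f (s k))%R by apply: fi; rewrite lt ltn_ord.
  by apply/Rabs_gt_mid => //; have := h _ _ lt; rewrite !permK ltnNge (ltnW kk').
Qed.

(** A pattern prescribes which midpoints lie left ([lo]) and right ([hi]) of the observer. This
    separation carries over from [f] to [g], where a new observer fits in between. *)
Lemma same_order_RP_nat_sub m f g : increasing_nat m f -> increasing_nat m g ->
  same_order m f g -> RP_nat m f \subset RP_nat m g.
Proof.
move=> fi gi fg; apply/subsetP => s /(RP_natP _ fi)[y h]; apply/(RP_natP _ gi).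
pose mid (p : 'I_m * 'I_m) := ((g p.1 + g p.2) / 2)%R.
pose lo (p : 'I_m * 'I_m) := (p.1 < p.2)%nat && ~~ ((s^-1)%g p.1 < (s^-1)%g p.2)%nat.
pose hi (p : 'I_m * 'I_m) := (p.1 < p.2)%nat && ((s^-1)%g p.1 < (s^-1)%g p.2)%nat.
have [|y' [h1 h2]] := @exists_between _ mid lo hi.
  move=> [a b] [c d]; rewrite /lo /hi /mid /= => /andP[ab /negbTE s1] /andP[cd s2].
  have := h _ _ ab; have := h _ _ cd; rewrite s1 s2 => l1 l2.
  have := @fg a b c d; rewrite ab cd !ltn_ord => /(_ isT isT); lra.
exists y' => a b ab; case: ifPn => sab.
  by apply: (h2 (a, b)); rewrite /hi /= ab sab.
by apply: (h1 (a, b)); rewrite /lo /= ab sab.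
Qed.

Lemma same_order_sym m f g : generic_nat m f -> increasing_nat m g ->
  same_order m f g -> same_order m g f.
Proof.
move=> gf gi fg i j k l ij kl lt.
have ne : (i, j) <> (k, l) by case=> e1 e2; move: lt; rewrite e1 e2; lra.
have := gf _ _ _ _ ij kl ne; have := fg _ _ _ _ kl ij; lra.
Qed.

(** The permutation sends an index to its rank, the number of indices with smaller value. *)
Lemma sorting_perm m (h : 'I_m -> R) : injective h ->
  exists s : 'S_m, forall a b : 'I_m, (s a < s b)%nat <-> (h a < h b)%R.
Proof.
move=> hi; pose lt a b := `[< (h a < h b)%R >].
have rkm a : (#|[set c | lt c a]| < m)%nat.
  rewrite -[X in (_ < X)%nat]card_ord; apply/proper_card/properP; split; first exact/subsetP.
  by exists a; rewrite // inE; apply/asboolP; lra.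
pose rk a : 'I_m := Ordinal (rkm a).
have mono a b : (h a < h b)%R -> (rk a < rk b)%nat.
  move=> ab; apply/proper_card/properP; split.
    by apply/subsetP => c; rewrite !inE => /asboolP ca; apply/asboolP; lra.
  by exists a; rewrite inE; apply/asboolP; lra.
have rki : injective rk.
  move=> a b e; apply: hi; case: (total_order_T (h a) (h b)) => [[/mono|//]|/mono];
  by rewrite e ltnn.
exists (perm rki) => a b; rewrite !permE; split; last exact: mono.
move=> ab; case: (total_order_T (h a) (h b)) => [[//|/hi e]|/mono]; last by lia.
by rewrite e ltnn in ab.
Qed.

Lemma RP_nat_same_order m f g : increasing_nat m f -> increasing_nat m g ->
  generic_nat m f -> generic_nat m g ->
  RP_nat m f = RP_nat m g -> same_order m f g.
Proof.
move=> fi gi gf gg eRP i j k l ijm klm lt; apply: contrapT => nlt.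
have /andP[ij jm] := ijm; have /andP[kl lm] := klm.
have ne : (i, j) <> (k, l) by case=> e1 e2; move: lt; rewrite e1 e2; lra.
have := gg _ _ _ _ ijm klm ne => ng.
(* The observer sits just right of the midpoint of [i, j]: still left of that of [k, l], and off
   every midpoint, so that all distances differ. The pattern seen there forces the same comparison
   in [g]. *)
have [e e0 [he1 he2]] : exists2 e, (0 < e)%R & ((f i + f j) / 2 + e < (f k + f l) / 2)%R /\
    forall p : 'I_m * 'I_m, (p.1 < p.2)%nat -> ((f i + f j) / 2 + e <> (f p.1 + f p.2) / 2)%R.
  apply: near0_ex; apply: near0_and.
    have [|d d0 hd] := @near0_pos ((f k + f l) / 2 - (f i + f j) / 2)%R (-1); first by lra.
    by exists d => // e /hd; lra.
  apply: near0_all => -[a b] /=; apply: near0_imp => ab.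
  have [|d d0 hd] := @near0_neq ((f i + f j) / 2 - (f a + f b) / 2)%R 1; first by right; lra.
  by exists d => // e /hd; lra.
set y := ((f i + f j) / 2 + e)%R in he1 he2.
have hneq (a b : 'I_m) : (a < b)%nat -> Rabs (y - f a) <> Rabs (y - f b).
  move=> ab; have fab : (f a < f b)%R by apply: fi; rewrite ab ltn_ord.
  by have := he2 (a, b) ab => /=; rewrite /Rabs; case: Rcase_abs; case: Rcase_abs; lra.
have [|s hs] := @sorting_perm m (fun a => Rabs (y - f a)).
  move=> a b e'; apply: val_inj; case: (ltngtP a b) => // /hneq; rewrite e' //.
have : (s^-1)%g \in RP_nat m f.
  apply/(RP_natP _ fi); exists y => a b ab; rewrite invgK.
  have fab : (f a < f b)%R by apply: fi; rewrite ab ltn_ord.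
  have := hneq _ _ ab; case: ifPn => [/hs /(Rabs_lt_mid _ fab) //|/negP].
  by rewrite hs => h1 h2; apply/Rabs_gt_mid => //; lra.
rewrite eRP => /(RP_natP _ gi)[z]; rewrite invgK => hz.
have im := ltn_trans ij jm; have km := ltn_trans kl lm.
have fij := fi _ _ ijm; have fkl := fi _ _ klm.
have := hz (Ordinal im) (Ordinal jm) ij; have := hz (Ordinal km) (Ordinal lm) kl => /=.
have -> : (s (Ordinal km) < s (Ordinal lm))%nat.
  by apply/hs; apply/Rabs_lt_mid.
have /negbTE -> : ~~ (s (Ordinal im) < s (Ordinal jm))%nat.
  by apply/negP => /hs /(Rabs_lt_mid _ fij) /=; rewrite /y; lra.
by move=> h1 h2; lra.
Qed.

Lemma RP_nat_eqP m f g : increasing_nat m f -> increasing_nat m g ->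
  generic_nat m f -> generic_nat m g ->
  RP_nat m f = RP_nat m g <-> same_order m f g.
Proof.
move=> fi gi gf gg; split; first exact: RP_nat_same_order.
move=> fg; apply/eqP; rewrite eqEsubset !same_order_RP_nat_sub //; exact: same_order_sym.
Qed.

(** * Lower bound: adding a point *)

Lemma near0_all_nat m (P : nat -> R -> Prop) :
  (forall i, (i < m)%nat -> near0 (P i)) -> near0 (fun e => forall i, (i < m)%nat -> P i e).
Proof.
move=> h; have [|d d0 hd] := @near0_all 'I_m (fun i => P i); first by move=> i; exact: h.
by exists d => // e /hd he i im; exact: (he (Ordinal im)).
Qed.

(** At [t = f k + f l - f j] the midpoint of [f j] and a new point [t] meets that of [f k] and
    [f l]. Distinctness means that a moving [t] meets these coincidences one at a time. *)
Definition distinct_walls m (f : nat -> R) := forall j k l j' k' l',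
  (j < k < l)%nat -> (l < m)%nat -> (j' < k' < l')%nat -> (l' < m)%nat ->
  (j, k, l) <> (j', k', l') -> (f k + f l - f j <> f k' + f l' - f j')%R.

(** In base 3 the highest power outweighs the others, so [l], then [k], then [j] can be read off. *)
Lemma expn3_triple j k l j' k' l' : (j < k < l)%nat -> (j' < k' < l')%nat ->
  (expn 3 k + expn 3 l + expn 3 j' = expn 3 k' + expn 3 l' + expn 3 j)%nat ->
  (j, k, l) = (j', k', l').
Proof.
have lt3 a b : (a < b)%nat -> (muln 3 (expn 3 a) <= expn 3 b)%nat.
  by move=> ab; rewrite -expnS leq_exp2l.
have gt0 a : (0 < expn 3 a)%nat by rewrite expn_gt0.
move=> /andP[jk kl] /andP[jk' kl'] e.
have el : l = l'.
  have := gt0 k; have := gt0 k'; have := gt0 j; have := gt0 j'.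
  have := lt3 _ _ jk; have := lt3 _ _ jk'; have := lt3 _ _ kl; have := lt3 _ _ kl'.
  by case: (ltngtP l l') => // /lt3; lia.
have ek : k = k'.
  have := gt0 k; have := gt0 k'; have := gt0 j; have := gt0 j'.
  have := lt3 _ _ jk; have := lt3 _ _ jk'; rewrite el in e.
  by case: (ltngtP k k') => // /lt3; lia.
rewrite el ek in e *; congr (_, _, _).
by apply/eqP; rewrite -(@eqn_exp2l 3) //; apply/eqP; lia.
Qed.

(* Perturbing along u i = 3 ^ i separates all walls, by expn3_triple. *)
Lemma perturb_distinct_walls m f : generic_nat m f -> increasing_nat m f ->
  exists g, [/\ generic_nat m g, increasing_nat m g, distinct_walls m g & RP_nat m g = RP_nat m f].
Proof.
move=> gf fi; pose u i := INR (expn 3 i)%nat.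
pose g e i := (f i + e * u i)%R.
have [e e0 [[ge ie] [se fg]]] : exists2 e, (0 < e)%R &
    (generic_nat m (g e) /\ increasing_nat m (g e)) /\
    (distinct_walls m (g e) /\ same_order m f (g e)).
  apply: near0_ex; apply: near0_and; apply: near0_and.
  - have [|d d0 hd] := @near0_all ('I_m * 'I_m * ('I_m * 'I_m))%type (fun p e =>
      (p.1.1 < p.1.2)%nat -> (p.2.1 < p.2.2)%nat -> (p.1.1, p.1.2) <> (p.2.1, p.2.2) ->
      (g e p.1.1 + g e p.1.2 <> g e p.2.1 + g e p.2.2)%R).
      case=> -[a b] [c d] /=; apply: near0_imp => ab.
      apply: near0_imp => cd; apply: near0_imp => ne.
      have [|d0 d00 hd] := @near0_neq (f a + f b - (f c + f d)) (u a + u b - (u c + u d)).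
        left; have := @gf a b c d; rewrite !ltn_ord !andbT => h.
        suff: (f a + f b <> f c + f d)%R by lra.
        by apply: h => // -[e1 e2]; apply: ne; congr pair; exact: val_inj.
      by exists d0 => // e /hd; rewrite /g; lra.
    exists d => // e /hd he i j k l /andP[ij jm] /andP[kl lm] ne.
    apply: (he (Ordinal (ltn_trans ij jm), Ordinal jm,
                (Ordinal (ltn_trans kl lm), Ordinal lm))) => //=.
    by case=> e1 e2; apply: ne; rewrite e1 e2.
  - have h : near0 (fun e => forall j, (j < m)%nat -> forall i, (i < j)%nat -> (g e i < g e j)%R).
      apply: near0_all_nat => j jm; apply: near0_all_nat => i ij.
      have [|d d0 hd] := @near0_pos (f j - f i) (u j - u i).
        by have := fi i j; rewrite ij jm => /(_ isT); lra.
      by exists d => // e /hd; rewrite /g; lra.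
    by case: h => d d0 hd; exists d => // e /hd he i j /andP[ij jm]; exact: he.
  - have h : near0 (fun e => forall l, (l < m)%nat -> forall k, (k < l)%nat ->
      forall j, (j < k)%nat ->
      forall l', (l' < m)%nat -> forall k', (k' < l')%nat -> forall j', (j' < k')%nat ->
      (j, k, l) <> (j', k', l') -> (g e k + g e l - g e j <> g e k' + g e l' - g e j')%R).
      apply: near0_all_nat => l lm; apply: near0_all_nat => k kl; apply: near0_all_nat => j jk.
      apply: near0_all_nat => l' lm'; apply: near0_all_nat => k' kl'.
      apply: near0_all_nat => j' jk'.
      apply: near0_imp => ne.
      have [|d d0 hd] := @near0_neq (f k + f l - f j - (f k' + f l' - f j'))
        (u k + u l - u j - (u k' + u l' - u j')).
        (* Walls of [f] itself may coincide, so it is the coefficient of [e] that must be nonzero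
           here. *)
        right=> eu; apply: ne; apply: expn3_triple; rewrite ?jk ?jk' //.
        by apply: INR_eq; rewrite !plus_INR; move: eu; rewrite /u; lra.
      by exists d => // e /hd; rewrite /g; lra.
    case: h => d d0 hd; exists d => // e /hd he j k l j' k' l' /andP[jk kl] lm /andP[jk' kl'] lm'.
    exact: he.
  have h : near0 (fun e => forall j, (j < m)%nat -> forall i, (i < j)%nat ->
      forall l, (l < m)%nat -> forall k, (k < l)%nat ->
      (f i + f j < f k + f l)%R -> (g e i + g e j < g e k + g e l)%R).
    apply: near0_all_nat => j jm; apply: near0_all_nat => i ij.
    apply: near0_all_nat => l lm; apply: near0_all_nat => k kl; apply: near0_imp => lt.
    have [|d d0 hd] := @near0_pos (f k + f l - (f i + f j)) (u k + u l - (u i + u j)); first by lra.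
    by exists d => // e /hd; rewrite /g; lra.
  by case: h => d d0 hd; exists d => // e /hd he i j k l /andP[ij jm] /andP[kl lm]; exact: he.
by exists (g e); split=> //; apply/esym/RP_nat_eqP.
Qed.

(* The point x_k + x_l - x_j lies to the right of all points of the configuration. *)
Definition walls m (f : nat -> R) : {set 'I_m * 'I_m * 'I_m} :=
  [set p : 'I_m * 'I_m * 'I_m | (p.1.1 < p.1.2 < p.2)%nat &&
    `[< (f p.1.1 + f m.-1 < f p.1.2 + f p.2)%R >]].

Definition extend m (f : nat -> R) t i := if i == m then t else f i.

Lemma extend_max m f t : extend m f t m = t.
Proof. by rewrite /extend eqxx. Qed.
Lemma extend_lt m f t i : (i < m)%nat -> extend m f t i = f i.
Proof. by move=> im; rewrite /extend ltn_eqF. Qed.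

(** Place [t] just right of the wall: avoiding all values [f k + f l - f i] keeps the extension
    generic, and a small step crosses no further wall. *)
Lemma extend_wall m f (p : 'I_m * 'I_m * 'I_m) :
  generic_nat m f -> increasing_nat m f -> p \in walls m f ->
  exists t, [/\ generic_nat m.+1 (extend m f t), increasing_nat m.+1 (extend m f t),
    (f p.1.2 + f p.2 - f p.1.1 < t)%R &
    forall q : 'I_m * 'I_m * 'I_m, (f p.1.2 + f p.2 - f p.1.1 < f q.1.2 + f q.2 - f q.1.1)%R ->
      (t < f q.1.2 + f q.2 - f q.1.1)%R].
Proof.
move=> gf fi; set w := (f p.1.2 + f p.2 - f p.1.1)%R; rewrite inE => /andP[_ /asboolP wm].
have [e e0 [h1 h2]] : exists2 e, (0 < e)%R &
    (forall q : 'I_m * 'I_m * 'I_m, w + e <> f q.1.2 + f q.2 - f q.1.1)%R /\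
    forall q : 'I_m * 'I_m * 'I_m, (w < f q.1.2 + f q.2 - f q.1.1)%R ->
      (w + e < f q.1.2 + f q.2 - f q.1.1)%R.
  apply: near0_ex; apply: near0_and; apply: near0_all => -[[a b] c] /=.
    have [|d d0 hd] := @near0_neq (w - (f b + f c - f a)) 1; first by right; lra.
    by exists d => // e /hd; lra.
  apply: near0_imp => lt.
  have [|d d0 hd] := @near0_pos (f b + f c - f a - w) (-1); first by lra.
  by exists d => // e /hd; lra.
have neq i k l : (i < m)%nat -> (k < m)%nat -> (l < m)%nat -> (f i + (w + e) <> f k + f l)%R.
  by move=> im km lm; have := h1 (Ordinal im, Ordinal km, Ordinal lm) => /=; lra.
have wt : (f m.-1 < w + e)%R by rewrite /w; lra.
exists (w + e)%R; split=> //; last by lra.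
- have lt i j : (i < j < m.+1)%nat -> (i < m)%nat by lia.
  move=> i j k l ijm klm ne.
  have im := lt _ _ ijm; have km := lt _ _ klm.
  rewrite (extend_lt _ _ im) (extend_lt _ _ km) /extend.
  case: eqVneq => jm; case: eqVneq => lm.
  + have : i <> k by move=> ik; apply: ne; rewrite ik jm lm.
    by case: (ltngtP i k) => // ik _; [have := fi i k|have := fi k i];
       rewrite ik ?im ?km => /(_ isT); lra.
  + by apply: neq => //; lia.
  + by apply/nesym; apply: neq => //; lia.
  + by apply: gf => //; lia.
- move=> i j ijm; rewrite (@extend_lt m _ _ i); last by lia.
  rewrite /extend; case: eqVneq => jm; last by apply: fi; lia.
  have [->|im] := eqVneq i m.-1; first exact: wt.
  by have := fi i m.-1 ltac:(lia); lra.
Qed.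

(** * Summing the number of walls over all patterns *)

Definition RP0s m := [set S : {set 'S_m} | `[< is_RP0 S >] ].

Definition representatives m (rep : {set 'S_m} -> nat -> R) := forall S, S \in RP0s m ->
  [/\ generic_nat m (rep S), increasing_nat m (rep S),
      distinct_walls m (rep S) & RP_nat m (rep S) = S].

Lemma exists_representatives m : exists rep : {set 'S_m} -> nat -> R, representatives rep.
Proof.
have [S|rep hrep] := @boolp.choice _ _ (fun S f => S \in RP0s m ->
  [/\ generic_nat m f, increasing_nat m f, distinct_walls m f & RP_nat m f = S]).
  2: by exists rep.
have [/[1!inE] /asboolP /is_RP0_nat[f [gf fi <-]]|_] := boolP (S \in RP0s m); last by exists INR.
by have [g] := perturb_distinct_walls gf fi; exists g.
Qed.

Lemma card_sigma_set (I J : finType) (A : {set I}) (B : I -> {set J}) :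
  #|[set p : I * J | (p.1 \in A) && (p.2 \in B p.1)]| = (\sum_(i in A) #|B i|)%nat.
Proof.
under eq_bigr => i _ do rewrite -sum1_card.
by rewrite pair_big_dep /= -sum1_card; apply: eq_bigl => p; rewrite inE.
Qed.

Lemma RP_nat_RP0s m f : generic_nat m f -> increasing_nat m f -> RP_nat m f \in RP0s m.
Proof. by move=> gf fi; rewrite inE; apply/asboolP/is_RP0_nat; exists f. Qed.

Lemma same_order_extend m f g t t' :
  same_order m.+1 (extend m f t) (extend m g t') -> same_order m f g.
Proof.
move=> h i j k l ij kl.
have := h i j k l; rewrite !extend_lt; try lia; by apply; lia.
Qed.

(** A pattern together with one of its walls yields the pattern extended by a point just right of
    that wall. The first [m] points recover the old pattern, and the position of the new point among
    the distinct walls recovers the wall. *)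
Lemma sum_walls_le_r0 m (rep : {set 'S_m} -> nat -> R) : representatives rep ->
  (\sum_(S in RP0s m) #|walls m (rep S)| <= r0 m.+1)%nat.
Proof.
move=> hrep; rewrite -card_sigma_set; set D := [set p | _].
pose w f (p : 'I_m * 'I_m * 'I_m) : R := (f (p.1.2 : nat) + f (p.2 : nat) - f (p.1.1 : nat))%R.
have [q|t ht] := @boolp.choice _ _
  (fun (q : {set 'S_m} * ('I_m * 'I_m * 'I_m)) (u : R) => q \in D ->
   [/\ generic_nat m.+1 (extend m (rep q.1) u), increasing_nat m.+1 (extend m (rep q.1) u),
    (w (rep q.1) q.2 < u)%R &
    forall p, (w (rep q.1) q.2 < w (rep q.1) p)%R -> (u < w (rep q.1) p)%R]).
  have [|_] := boolP (q \in D); last by exists 0%R.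
  rewrite inE => /andP[/hrep[gf fi _ _] /(extend_wall gf fi)[u hu]].
  by exists u.
pose phi q := RP_nat m.+1 (extend m (rep q.1) (t q)).
have inj : {in D &, injective phi}.
  move=> [S p] [S' p'] qD qD'; have [g1 i1 l1 u1] := ht _ qD; have [g2 i2 l2 u2] := ht _ qD'.
  move=> /(RP_nat_eqP i1 i2 g1 g2) e.
  have e' : same_order m.+1 (extend m (rep S') (t (S', p'))) (extend m (rep S) (t (S, p))).
    exact: same_order_sym g1 i2 e.
  move: (qD); rewrite inE /= => /andP[SD]; rewrite inE => /andP[pl _].
  move: (qD'); rewrite inE /= => /andP[SD']; rewrite inE => /andP[pl' _].
  have [gf fi sf fS] := hrep _ SD; have [gf' fi' sf' fS'] := hrep _ SD'.
  have eS : S = S'.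
    rewrite -fS -fS'; apply/RP_nat_eqP => //; exact: same_order_extend e.
  subst S'; congr pair; apply: contrapT => ne.
  have nw : w (rep S) p <> w (rep S) p'.
    apply: sf; rewrite ?ltn_ord // => -[e1 e2 e3]; apply: ne.
    case: p p' e1 e2 e3 {qD qD' l1 l2 u1 u2 e e' g1 g2 i1 i2 pl pl'} => [[a b] c] [[a' b'] c'] /=.
    by move=> /val_inj -> /val_inj -> /val_inj ->.
  (* If the wall of [q] lies left of that of [q'], the latter separates the two added points, so one
     comparison of midpoints differs between the extensions. *)
  suff key (q q' : 'I_m * 'I_m * 'I_m) : (q.1.1 < q.1.2 < q.2)%nat ->
      (q'.1.1 < q'.1.2 < q'.2)%nat ->
      (w (rep S) q < t (S, q))%R -> (w (rep S) q' < t (S, q'))%R ->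
      (forall p, (w (rep S) q < w (rep S) p)%R -> (t (S, q) < w (rep S) p)%R) ->
      same_order m.+1 (extend m (rep S) (t (S, q))) (extend m (rep S) (t (S, q'))) ->
      (w (rep S) q < w (rep S) q')%R -> False.
    have := key p p' pl pl' l1 l2 u1 e; have := key p' p pl' pl l2 l1 u2 e'; lra.
  move=> ql ql' lq lq' uq ee /uq h.
  have := ee q'.1.1 m q'.1.2 q'.2; rewrite !extend_max !extend_lt ?ltn_ord //.
  have [qm1 qm2] := (ltn_ord q'.1.1, ltn_ord q'.2).
  move=> /(_ ltac:(lia) ltac:(lia)).
  by move: h lq'; rewrite /w; lra.
rewrite -(card_in_imset inj); apply/subset_leq_card/subsetP => _ /imsetP[q /ht[? ? _ _] ->].
exact: RP_nat_RP0s.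
Qed.

(** * Reflection of configurations *)

Definition mirror m (f : nat -> R) i := (- f (m.-1 - i)%nat)%R.

Lemma mirror_increasing m f : increasing_nat m f -> increasing_nat m (mirror m f).
Proof.
by move=> fi i j ij; have := fi (m.-1 - j)%nat (m.-1 - i)%nat ltac:(lia); rewrite /mirror; lra.
Qed.

Lemma mirror_generic m f : generic_nat m f -> generic_nat m (mirror m f).
Proof.
move=> gf i j k l ij kl ne.
have := gf (m.-1 - j)%nat (m.-1 - i)%nat (m.-1 - l)%nat (m.-1 - k)%nat ltac:(lia) ltac:(lia).
rewrite /mirror => h.
suff /h ? : ((m.-1 - j)%nat, (m.-1 - i)%nat) <> ((m.-1 - l)%nat, (m.-1 - k)%nat) by lra.
by case=> e1 e2; apply: ne; congr pair; lia.
Qed.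

Lemma mirror_same_order m f g : same_order m (mirror m f) (mirror m g) -> same_order m f g.
Proof.
move=> h i j k l ij kl.
have := h (m.-1 - l)%nat (m.-1 - k)%nat (m.-1 - j)%nat (m.-1 - i)%nat ltac:(lia) ltac:(lia).
rewrite /mirror !subKn; try lia; lra.
Qed.

Lemma walls_same_order m f g : same_order m f g -> walls m f \subset walls m g.
Proof.
move=> h; apply/subsetP => -[[a b] c]; rewrite !inE /= => /andP[abc /asboolP lt].
by rewrite abc; apply/asboolP; apply: h => //; have := ltn_ord c; lia.
Qed.

(** Reflection acts injectively on the finite set of patterns, hence permutes it, and the walls
    depend on the pattern alone; so the sum can be reindexed by [rho]. *)
Lemma sum_walls_mirror m (rep : {set 'S_m} -> nat -> R) : representatives rep ->
  (\sum_(S in RP0s m) #|walls m (mirror m (rep S))| <= \sum_(S in RP0s m) #|walls m (rep S)|)%nat.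
Proof.
move=> hrep; pose rho S := RP_nat m (mirror m (rep S)).
have inj : {in RP0s m &, injective rho}.
  move=> S S' /hrep[gf fi _ fS] /hrep[gf' fi' _ fS'].
  move=> /(RP_nat_eqP (mirror_increasing fi) (mirror_increasing fi')
    (mirror_generic gf) (mirror_generic gf')) /mirror_same_order e.
  by rewrite -fS -fS'; apply/RP_nat_eqP.
have sub : rho @: RP0s m \subset RP0s m.
  apply/subsetP => _ /imsetP[S /hrep[gf fi _ _] ->].
  by apply: RP_nat_RP0s; [apply: mirror_generic|apply: mirror_increasing].
have -> : (\sum_(S in RP0s m) #|walls m (rep S)| =
    \sum_(S in rho @: RP0s m) #|walls m (rep S)|)%nat.
  apply: eq_bigl => S; rewrite (_ : rho @: RP0s m = RP0s m) //.
  by apply/eqP; rewrite eqEcard sub card_in_imset /=.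
rewrite big_imset //=; apply: leq_sum => S SD.
have [gf fi _ _] := hrep _ SD.
have [gf' fi' _ e] := hrep (rho S) (subsetP sub _ (imset_f _ SD)).
apply/subset_leq_card/walls_same_order.
exact: (RP_nat_same_order (mirror_increasing fi) fi' (mirror_generic gf) gf' (esym e)).
Qed.

(** * Counting the walls of a configuration and of its reflection *)

Definition lt_pairs n := [set p : 'I_n * 'I_n | (p.1 < p.2)%nat].

Lemma card_lt_pairs n : #|lt_pairs n| = 'C(n, 2).
Proof.
rewrite -bin2_sum big_mkord -sum1_card.
rewrite (eq_bigl (fun p : 'I_n * 'I_n => true && (p.1 < p.2)%nat)); last by move=> p; rewrite inE.
rewrite -(pair_big_dep xpredT (fun i j : 'I_n => (i < j)%nat) (fun _ _ => 1%nat)) /=.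
rewrite (exchange_big_dep xpredT) //=; apply: eq_bigr => j _.
by rewrite (big_ord_narrow (ltnW (ltn_ord j))) sum1_card card_ord.
Qed.

(** The pair [(a, b)] stands for the triple [(0, a+1, b+1)] in a configuration of [n+2] points,
    whose last index is [n+1]. *)
Definition inner_walls n (f : nat -> R) : {set 'I_n * 'I_n} :=
  [set p in lt_pairs n | `[< (f 0%nat + f n.+1 < f p.1.+1 + f p.2.+1)%R >]].

(** Triples ending in the last index are walls by monotonicity ([h1]); inner walls ([h2]) end
    earlier, so the two families are disjoint. *)
Lemma card_walls_ge n f : increasing_nat n.+2 f ->
  ('C(n.+1, 2) + #|inner_walls n f| <= #|walls n.+2 f|)%nat.
Proof.
move=> fi; rewrite -card_lt_pairs.
pose h1 (p : 'I_n.+1 * 'I_n.+1) : 'I_n.+2 * 'I_n.+2 * 'I_n.+2 := (inord p.1, inord p.2, ord_max).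
pose h2 (p : 'I_n * 'I_n) : 'I_n.+2 * 'I_n.+2 * 'I_n.+2 := (ord0, inord p.1.+1, inord p.2.+1).
have v1 (i : 'I_n.+1) : (inord i : 'I_n.+2) = i :> nat by rewrite inordK // ltnS ltnW.
have v2 (i : 'I_n) : (inord i.+1 : 'I_n.+2) = i.+1 :> nat by rewrite inordK // !ltnS ltnW.
have inj1 : injective h1.
  by move=> [a b] [c d] [/(congr1 val) + /(congr1 val)]; rewrite /= !v1 => /val_inj -> /val_inj ->.
have inj2 : injective h2.
  by move=> [a b] [c d] [/(congr1 val) + /(congr1 val)];
    rewrite /= !v2 => -[/val_inj ->] [/val_inj ->].
rewrite -(card_imset _ inj1) -(card_imset (inner_walls n f) inj2).
rewrite -cardsUI [X in (_ + X)%nat](_ : _ = 0%nat) ?addn0.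
  apply/subset_leq_card/subsetP => _ /setUP[]/imsetP[p] + ->; rewrite !inE /= ?v1 ?v2.
    move=> plt; rewrite plt ltn_ord; apply/asboolP.
    by have := fi p.1 p.2; rewrite plt ltnS ltnW ?ltn_ord // => /(_ isT); exact: Rplus_lt_compat_r.
  by move=> /andP[lt h]; rewrite h andbT; lia.
apply/eqP; rewrite cards_eq0; apply/eqP/setP => q; rewrite in_set0; apply/negbTE.
apply/negP => /setIP[/imsetP[p _ ->] /imsetP[p' _ [_ _ /(congr1 val)]]].
by rewrite /= v2 => -[e]; have := ltn_ord p'.2; rewrite -e ltnn.
Qed.

(* The mirror image of the pair (a, b) is (n-1-b, n-1-a), and the inequality is reversed. *)
Lemma card_inner_walls_mirror n f : generic_nat n.+2 f ->
  ('C(n, 2) <= #|inner_walls n f| + #|inner_walls n (mirror n.+2 f)|)%nat.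
Proof.
move=> gf; rewrite -card_lt_pairs -(cardsID (inner_walls n f) (lt_pairs n)).
apply: leq_add.
  by apply/subset_leq_card/subsetP => p /setIP[].
pose h (p : 'I_n * 'I_n) := (rev_ord p.2, rev_ord p.1).
have hi : injective h.
  move=> [a b] [c d] e; have /rev_ord_inj /= -> := congr1 fst e.
  by have /rev_ord_inj /= -> := congr1 snd e.
rewrite -(card_imset _ hi); apply/subset_leq_card/subsetP => _ /imsetP[[a b] /setDP[pl pw] ->].
move: pl pw; rewrite !inE /= => ab; rewrite ab /= => /asboolP lt.
have [an bn] := (ltn_ord a, ltn_ord b).
rewrite /mirror /= subn0 subnn; apply/andP; split; first by lia.
have -> : (n.+1 - (n - b.+1).+1 = b.+1)%nat by lia.
have -> : (n.+1 - (n - a.+1).+1 = a.+1)%nat by lia.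
apply/asboolP; have := @gf 0%nat n.+1 a.+1 b.+1 ltac:(lia) ltac:(lia) ltac:(by case; lia); lra.
Qed.

(** A configuration and its reflection have at least [(3 n^2 + n) / 2] walls together, while the two
    sums over all patterns total at most [2 * r0 n.+3]. *)
Lemma r0_step n : (3 * (n * n) * r0 n.+2 <= 4 * r0 n.+3)%nat.
Proof.
have [rep hrep] := exists_representatives n.+2.
have h1 := sum_walls_le_r0 hrep; have h2 := sum_walls_mirror hrep.
have h : (r0 n.+2 * (2 * 'C(n.+1, 2) + 'C(n, 2)) <= \sum_(S in RP0s n.+2) #|walls n.+2 (rep S)| +
   \sum_(S in RP0s n.+2) #|walls n.+2 (mirror n.+2 (rep S))|)%nat.
  rewrite -big_split /= -sum_nat_const; apply: leq_sum => S /hrep[gf fi _ _].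
  apply: leq_trans (leq_add (card_walls_ge fi) (card_walls_ge (mirror_increasing fi))).
  by rewrite addnACA addnn -mul2n leq_add2l card_inner_walls_mirror.
have le : (r0 n.+2 * (2 * 'C(n.+1, 2) + 'C(n, 2)) <= 2 * r0 n.+3)%nat.
  by apply: leq_trans h _; rewrite mul2n -addnn leq_add // (leq_trans h2).
have cn : (3 * (n * n) <= 2 * (2 * 'C(n.+1, 2) + 'C(n, 2)))%nat.
  have b1 := mul_bin_diag n.+1 1; have b2 := mul_bin_diag n 1; rewrite !bin1 /= in b1 b2.
  rewrite mulnDr -b1 -b2; case: (n) => // k /=; lia.
apply: (@leq_trans (2 * (r0 n.+2 * (2 * 'C(n.+1, 2) + 'C(n, 2))))); last by lia.
by rewrite [X in _ <= X]mulnCA mulnC leq_mul2l cn orbT.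
Qed.

Lemma r0_4 : (2 <= r0 4)%nat.
Proof.
(* The configurations are 0, 1, 2, 4 and 0, 2, 3, 4; the inner midpoint lies left of the outer one
   in the first and right of it in the second. *)
pose f := fun i => if i is 3 then 4%R else INR i.
pose g := fun i => if i is i'.+1 then (INR i' + 2)%R else 0%R.
have small n : (n < 4)%nat -> [\/ n = 0%nat, n = 1%nat, n = 2%nat | n = 3%nat].
  by case: n => [|[|[|[|]]]] // _; [constructor 1|constructor 2|constructor 3|constructor 4].
have inc h : (h 0%nat < h 1%nat)%R -> (h 1%nat < h 2%nat)%R -> (h 2%nat < h 3%nat)%R ->
    increasing_nat 4 h.
  move=> h01 h12 h23 i j /andP[ij /small jm].
  have /small im : (i < 4)%nat by case: jm; lia.
  by case: jm ij => ->; case: im => -> //= _; lra.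
have fi : increasing_nat 4 f by apply: inc; rewrite /f /=; lra.
have gi : increasing_nat 4 g by apply: inc; rewrite /g /=; lra.
have gf : generic_nat 4 f.
  move=> i j k l /andP[ij /small jm] /andP[kl /small lm].
  have /small im : (i < 4)%nat by case: jm; lia.
  have /small km : (k < 4)%nat by case: lm; lia.
  case: jm ij => -> ij; case: im ij => -> //= ij; case: lm kl => -> kl; case: km kl => -> //= kl ne;
    rewrite /f /=; try lra; by case: ne.
have gg : generic_nat 4 g.
  move=> i j k l /andP[ij /small jm] /andP[kl /small lm].
  have /small im : (i < 4)%nat by case: jm; lia.
  have /small km : (k < 4)%nat by case: lm; lia.
  case: jm ij => -> ij; case: im ij => -> //= ij; case: lm kl => -> kl; case: km kl => -> //= kl ne;
    rewrite /g /=; try lra; by case: ne.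
apply: (@leq_trans #|[set RP_nat 4 f; RP_nat 4 g]|).
  rewrite cards2; suff -> : RP_nat 4 f != RP_nat 4 g by [].
  apply/eqP => /(RP_nat_same_order fi gi gf gg)/(_ 1%nat 2%nat 0%nat 3%nat isT isT).
  by rewrite /f /g /=; lra.
by apply/subset_leq_card/subsetP => S /set2P[] ->; apply: RP_nat_RP0s.
Qed.

Lemma r0_lower k :
  (2 * (3 / 4) ^ k * (INR (k.+1`!)) ^ 2 <= INR (r0 k.+4))%R.
Proof.
elim: k => [|k IH].
  by have /leP/le_INR := r0_4; rewrite (_ : 1`! = 1%nat) //=; lra.
(* Passing from [k+4] to [k+5] points costs the factor [3/4 (k+2)^2], which turns [(k+1)!] squared
   into [(k+2)!] squared. *)
have /leP/le_INR st := r0_step k.+2; rewrite !mult_INR in st.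
have -> : INR k.+2`! = (INR k.+2 * INR k.+1`!)%R by rewrite factS; exact: mult_INR.
set a := INR k.+1`! in IH *; set b := INR k.+2 in st *; set r := INR (r0 k.+4) in IH st.
rewrite -[(_ ^ k.+1)%R]/((3/4) * (3/4) ^ k)%R.
have e3 : INR 3 = 3%R by rewrite /=; lra.
have e4 : INR 4 = 4%R by rewrite /=; lra.
rewrite e3 e4 in st.
have b0 : (0 <= b)%R by exact: pos_INR.
have := Rmult_le_compat_l (b * b) _ _ ltac:(nra) IH.
lra.
Qed.

(** * Upper bound: counting sign vectors *)

Import Order.TTheory GRing.Theory Num.Theory.

Section SetPairs.
Variable m : nat.
Implicit Types (p : {set 'I_m} * {set 'I_m}) (u : 'I_m -> R) (f : nat -> R).

(* The pair (A, B) stands for the linear form sum_B - sum_A, and half_balanced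
   keeps one of the two opposite forms (A, B) and (B, A). *)
Definition balanced : {set {set 'I_m} * {set 'I_m}} :=
  [set p : {set 'I_m} * {set 'I_m} |
    [&& [disjoint p.1 & p.2], #|p.1| == #|p.2| & (0 < #|p.1| <= 2)%nat]].
Definition half_balanced :=
  balanced :&: [set p : {set 'I_m} * {set 'I_m} | (enum_rank p.1 < enum_rank p.2)%nat].
Definition swap p := (p.2, p.1).

Lemma swap_balanced p : (swap p \in balanced) = (p \in balanced).
Proof.
rewrite !inE /= disjoint_sym [#|p.2| == _]eq_sym.
by case: (#|p.1| =P #|p.2|) => [->|]; rewrite ?andbF.
Qed.

Lemma balancedP p : p \in balanced -> (p \in half_balanced) || (swap p \in half_balanced).
Proof.
move=> pb; rewrite /half_balanced !in_setI swap_balanced pb /= !in_set /= -neq_ltn.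
apply/negP => /eqP /val_inj /enum_rank_inj e.
move: pb; rewrite inE e => /and3P[]; rewrite -setI_eq0 setIid => /eqP ->.
by rewrite cards0.
Qed.

(** Choose [A] of size 1 or 2, then [B] of the same size in its complement. *)
Lemma card_balanced : #|balanced| = (m * m.-1 + 'C(m, 2) * 'C(m - 2, 2))%nat.
Proof.
pose S k := [set A : {set 'I_m} | #|A| == k].
pose Bs A := [set B : {set 'I_m} | B \subset ~: A & #|B| == #|A|].
have -> : balanced =
    [set p : {set 'I_m} * {set 'I_m} | (p.1 \in S 1%nat :|: S 2%nat) && (p.2 \in Bs p.1)].
  apply/setP => -[A B]; rewrite !inE /= disjoint_sym disjoints_subset [#|A| == #|B|]eq_sym.
  rewrite [in RHS]andbC -andbA; congr [&& _, _ & _].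
  by case: #|A| => [|[|[|]]].
have cB A : #|Bs A| = 'C(m - #|A|, #|A|) by rewrite cards_draws cardsCs setCK card_ord.
rewrite card_sigma_set (eq_bigl (fun A => (A \in S 1%nat) || (A \in S 2%nat))).
  2: by move=> A; rewrite inE.
rewrite bigU /=; last first.
  by rewrite -setI_eq0; apply/eqP/setP => A; rewrite !inE; case: eqP => // ->.
have card_S k : #|S k| = 'C(m, k) by rewrite card_draws card_ord.
congr (_ + _)%nat.
  rewrite (eq_bigr (fun _ => m.-1)) => [|A].
    2: by rewrite inE => /eqP A1; rewrite cB A1 bin1 subn1.
  by rewrite sum_nat_const card_S bin1.
rewrite (eq_bigr (fun _ => 'C(m - 2, 2))) => [|A]; last by rewrite inE => /eqP A1; rewrite cB A1.
by rewrite sum_nat_const card_S.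
Qed.

Lemma card_half_balanced : (2 * #|half_balanced| <= #|balanced|)%nat.
Proof.
have si : injective swap by move=> [a b] [c d] [-> ->].
rewrite mul2n -addnn -[X in (_ + X)%nat](card_imset _ si) -cardsUI.
rewrite [X in (_ + X)%nat](_ : _ = 0%nat).
  rewrite addn0; apply/subset_leq_card/subsetP => p /setUP[/setIP[]//|/imsetP[q /setIP[qb _] ->]].
  by rewrite swap_balanced.
apply/eqP; rewrite cards_eq0; apply/eqP/setP => p; rewrite [RHS]in_set0; apply/negbTE/negP.
move=> /setIP[/setIP[_ l1] /imsetP[q /setIP[_ l2] e]].
by move: l1 l2; rewrite e !inE /= ltnNge => /negP l1 /ltnW.
Qed.

Definition form u p : R := (\sum_(i in p.2) u i - \sum_(i in p.1) u i)%ring.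

Lemma form_swap u p : form u (swap p) = (- form u p)%ring.
Proof. by rewrite /form opprB. Qed.

Definition nondegenerate u := forall p, p \in balanced -> form u p <> 0%R.

(** Since no form vanishes, the sign of a form determines that of its opposite. *)
Lemma form_signs u u' : nondegenerate u -> nondegenerate u' ->
  {in half_balanced, forall p, (0 < form u p)%ring = (0 < form u' p)%ring} ->
  {in balanced, forall p, (0 < form u p)%ring = (0 < form u' p)%ring}.
Proof.
move=> nu nu' h p pb; have /orP[/h //|/h] := balancedP pb.
rewrite !form_swap !oppr_gt0.
have /eqP n1 := nu _ pb; have /eqP n2 := nu' _ pb.
by move=> e; rewrite !ltNge !le_eqVlt (negbTE n1) (negbTE n2) e.
Qed.

Lemma form1 u a b : form u ([set a], [set b]) = (u b - u a)%R.
Proof. by rewrite /form /= !big_set1. Qed.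

Lemma form2 u a b c d : a != b -> c != d ->
  form u ([set a; b], [set c; d]) = (u c + u d - (u a + u b))%R.
Proof. by move=> ab cd; rewrite /form /= !big_setU1 ?inE //= !big_set1. Qed.

Lemma balanced1 (a b : 'I_m) : a != b -> ([set a], [set b]) \in balanced.
Proof. by move=> ab; rewrite inE /= !cards1 disjoints1 inE ab. Qed.

Lemma balanced2 (a b c d : 'I_m) : a != b -> c != d ->
  a != c -> a != d -> b != c -> b != d -> ([set a; b], [set c; d]) \in balanced.
Proof.
move=> ab cd ac ad bc bd; rewrite inE /= !cards2 ab cd /= andbT -setI_eq0.
apply/eqP/setP => x; rewrite !inE; apply/negbTE/negP => /andP[/orP[]/eqP -> /orP[]];
  exact/negP.
Qed.

Lemma increasing_nat_lt f i j : increasing_nat m f -> (i < m)%nat -> (j < m)%nat ->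
  (f i < f j)%R <-> (i < j)%nat.
Proof.
move=> fi im jm; split=> [|ij]; last by apply: fi; rewrite ij.
by case: (ltngtP i j) => // [ji|->]; [have := fi j i; rewrite ji im => /(_ isT)|]; lra.
Qed.

Lemma nondegenerate_perm f (s : 'S_m) : generic_nat m f -> increasing_nat m f ->
  nondegenerate (fun i => f (s i)).
Proof.
move=> gf fi [A B]; rewrite inE /= => /and3P[dAB /eqP eAB /andP[A0 A2]].
have sneq a b : a != b -> f (s a) <> f (s b).
  move=> /eqP ab; case: (ltngtP (s a) (s b)) => [lt|lt|/val_inj/perm_inj //];
  have := proj2 (increasing_nat_lt fi (ltn_ord _) (ltn_ord _)) lt; lra.
have : (#|A| == 1%nat) || (#|A| == 2%nat) by case: #|A| A0 A2 => [|[|[|]]].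
case/orP => cA; have cB := cA; rewrite eAB in cB.
  have /cards1P[a ea] := cA; have /cards1P[b eb] := cB; subst A B.
  by move: dAB; rewrite form1 disjoints1 inE => /sneq; lra.
have /cards2P[a [b [ab ea]]] := cA; have /cards2P[c [d [cd ec]]] := cB; subst A B.
rewrite form2 //.
(* Genericity wants sorted pairs; remembering where the smaller index comes from is enough to tell
   the two pairs apart by disjointness. *)
have sum a' b' : a' != b' -> exists i j, (i < j < m)%nat /\
    (f (s a') + f (s b') = f i + f j)%R /\ (i = s a' \/ i = s b').
  move=> n; case: (ltngtP (s a') (s b')) => [lt|lt|/val_inj/perm_inj e].
  - by exists (s a'), (s b'); rewrite lt ltn_ord; split=> //; split=> //; left.
  - by exists (s b'), (s a'); rewrite lt ltn_ord; split=> //; split; [lra|right].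
  - by rewrite e eqxx in n.
have [i [j [ij [-> hi]]]] := sum _ _ ab; have [k [l [kl [-> hk]]]] := sum _ _ cd.
have : (i, j) <> (k, l).
  case=> ik _; have nin x : x \in [set a; b] -> x \in [set c; d] -> False.
    by move=> x1 x2; move: dAB; rewrite -setI_eq0 => /eqP/setP/(_ x); rewrite inE x1 x2 inE.
  by move: ik; case: hi => ->; case: hk => -> /val_inj/perm_inj e;
    [apply: (nin a)|apply: (nin a)|apply: (nin b)|apply: (nin b)]; rewrite !inE ?e eqxx ?orbT.
by move=> /(gf _ _ _ _ ij kl); lra.
Qed.

(** The value [s a] is the number of [c] with [s c < s a]. *)
Lemma perm_order_inj (s s' : 'S_m) :
  (forall a b, (s a < s b)%nat = (s' a < s' b)%nat) -> s = s'.
Proof.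
move=> h; have card_lt (t : 'S_m) a : #|[set c | (t c < t a)%nat]| = t a.
  have -> : [set c | (t c < t a)%nat] = t @^-1: [set d : 'I_m | (d < t a)%nat].
    by apply/setP => c; rewrite !inE.
  rewrite on_card_preimset; last by apply: onW_bij; exact: Bijective (permK t) (permKV t).
  rewrite -sum1_card (eq_bigl (fun d : 'I_m => (d < t a)%nat)); last by move=> d; rewrite inE.
  by rewrite (big_ord_narrow (ltnW (ltn_ord (t a)))) sum1_card card_ord.
apply/permP => a; apply: val_inj; rewrite /= -(card_lt s) -(card_lt s').
by apply: eq_card => c; rewrite !inE h.
Qed.

(** Forms of size one give the order of the coordinates, hence [s]; forms of size two compare
    midpoints of disjoint pairs. Pairs with a common index ([share]) are settled by monotonicity. *)
Lemma signs_determine f f' (s s' : 'S_m) : generic_nat m f -> generic_nat m f' ->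
  increasing_nat m f -> increasing_nat m f' ->
  {in balanced, forall p,
    (0 < form (fun i => f (s i)) p)%ring = (0 < form (fun i => f' (s' i)) p)%ring} ->
  s = s' /\ same_order m f f'.
Proof.
move=> gf gf' fi fi' h.
have hs p : p \in balanced ->
    (0 < form (fun i => f (s i)) p)%R <-> (0 < form (fun i => f' (s' i)) p)%R.
  by move=> /h e; split=> /RltP l; apply/RltP; move: l; rewrite e.
have es : s = s'.
  apply: perm_order_inj => a b; have [->|ab] := eqVneq a b; first by rewrite !ltnn.
  have := hs _ (balanced1 ab); rewrite !form1 => h1.
  have h2 := increasing_nat_lt fi (ltn_ord (s a)) (ltn_ord (s b)).
  have h3 := increasing_nat_lt fi' (ltn_ord (s' a)) (ltn_ord (s' b)).
  by apply/idP/idP => [/h2 ?|/h3 ?]; [apply/h3|apply/h2]; lra.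
split=> //; subst s' => i j k l /andP[ij jm] /andP[kl lm] lt.
have im := ltn_trans ij jm; have km := ltn_trans kl lm.
have share a b c : (a < m)%nat -> (b < m)%nat -> (f a < f b)%R -> (f' c + f' a < f' c + f' b)%R.
  by move=> am bm /(increasing_nat_lt fi am bm) /(increasing_nat_lt fi' am bm); lra.
have [e|ik] := eqVneq i k; first by subst k; apply: share => //; lra.
have [e|il] := eqVneq i l; first by subst l; have := @share j k i jm km; lra.
have [e|jk] := eqVneq j k; first by subst k; have := @share i l j im lm; lra.
have [e|jl] := eqVneq j l; first by subst l; have := @share i k j im km; lra.
pose o x (xm : (x < m)%nat) := (s^-1)%g (Ordinal xm).
have ne x y (xm : (x < m)%nat) (ym : (y < m)%nat) : x != y -> o x xm != o y ym.
  by apply: contra => /eqP /perm_inj [] ->.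
have nij := ne _ _ im jm (negbT (ltn_eqF ij)); have nkl := ne _ _ km lm (negbT (ltn_eqF kl)).
have /hs := balanced2 nij nkl (ne _ _ im km ik) (ne _ _ im lm il)
  (ne _ _ jm km jk) (ne _ _ jm lm jl).
by rewrite !form2 // /o !permKV /=; lra.
Qed.

Definition form_row p : 'rV[R]_m := (\row_i ((i \in p.2)%:R - (i \in p.1)%:R))%ring.

Lemma form_rowE u p : ((form_row p *m (\col_i u i)) 0 0)%ring = form u p.
Proof.
rewrite mxE /form (big_mkcond (mem p.2)) (big_mkcond (mem p.1)) -sumrB.
apply: eq_bigr => i _; rewrite !mxE mulrBl !mulr_natl.
by rewrite !mulrb.
Qed.

(** The coefficients cancel, so all forms live in the space of dimension [m - 1] required by
    [cone_signs_card]. *)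
Lemma form_row_sum0 p : p \in balanced -> (form_row p *m const_mx 1 = 0 :> 'M_1)%ring.
Proof.
rewrite inE => /and3P[_ /eqP e _]; apply/rowP => j; rewrite ord1.
have -> : const_mx 1%ring = (\col_(i < m) (fun=> 1%ring) i)%ring :> 'cV[R]_m.
  by apply/colP => i; rewrite !mxE.
by rewrite form_rowE /form mxE !sumr_const e subrr.
Qed.

(** * Counting sign vectors with one prescribed sign *)

Definition signs p0 u := [set p in half_balanced :\ p0 | (0 < form u p)%ring].
Definition sign_class p0 (b : bool) := [set A | `[< exists u, [/\ nondegenerate u,
   (0 < form u p0)%ring = b & signs p0 u = A] >]].

Lemma card_sign_class p0 b : p0 \in half_balanced ->
  (#|sign_class p0 b| <= \sum_(i < m.-1) 'C(#|half_balanced|.-1, i))%nat.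
Proof.
move=> p0h; have /setIP[p0b _] := p0h.
have [A [B hp0]] : exists A B, p0 = (A, B) by case: (p0) => A B; exists A, B.
have m2 : (2 <= m)%nat.
  move: p0b; rewrite inE => /and3P[d /eqP e /andP[c0 _]].
  have := max_card [in p0.1 :|: p0.2]; rewrite cardsU card_ord.
  by move: d; rewrite -setI_eq0 => /eqP ->; rewrite cards0 -e; lia.
have -> : #|half_balanced|.-1 = #|half_balanced :\ p0| by rewrite (cardsD1 p0 half_balanced) p0h.
have -> : m.-1 = m.-2.+1 by lia.
apply: card_le_shattered_draws => [A' | Y /shattersP sY].
  by rewrite inE => /asboolP[u [_ _ <-]]; apply/subsetP => p /setIdP[].
have sub : Y \subset half_balanced :\ p0.
  have [A'] := sY _ (subxx _); rewrite inE => /asboolP[u [_ _ <-]] <-.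
  by apply/subsetP => p /setIP[/setIdP[]].
have Yb p : p \in Y -> p \in balanced by move=> /(subsetP sub) /setD1P[_ /setIP[]].
(* Oriented so that the prescribed sign becomes positivity of [v0]. *)
pose v0 := if b then form_row p0 else (- form_row p0)%ring.
suff : (#|Y|.+1 < m)%nat by lia.
apply: (@cone_signs_card _ _ _ v0 form_row).
- by rewrite /v0; case: b {sY v0}; rewrite ?mulNmx form_row_sum0 ?oppr0.
- by move=> p /Yb; exact: form_row_sum0.
move=> Z ZY; have [A'] := sY _ ZY; rewrite inE => /asboolP[u [nu sb <-]] eZ.
exists (\col_i u i)%ring; split.
  rewrite /v0; case: b sb {sY v0} => sb; first by rewrite form_rowE.
  rewrite mulNmx mxE form_rowE oppr_gt0 lt_neqAle leNgt sb andbT.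
  by apply/eqP; exact: nu.
move=> p pY; rewrite form_rowE -eZ inE pY andbT inE (subsetP sub _ pY) /=.
case: ltP => //; rewrite le_eqVlt => /orP[/eqP|//].
by move: (nu _ (Yb _ pY)).
Qed.

(** Permuting the coordinates of representatives makes [m! r0 m] nondegenerate points with distinct
    sign vectors; the factor 2 accounts for the sign of [p0]. *)
Lemma fact_r0_le : (1 < m)%nat ->
  (m`! * r0 m <= 2 * \sum_(i < m.-1) 'C(#|half_balanced|.-1, i))%nat.
Proof.
move=> m1.
have [p0 p0h] : exists p0, p0 \in half_balanced.
  have m0 : (0 < m)%nat by lia.
  have /balancedP/orP[h|h] : ([set Ordinal m0], [set Ordinal m1]) \in balanced by exact: balanced1.
    by eexists; exact: h.
  by eexists; exact: h.
have [rep hrep] := exists_representatives m.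
pose U (q : 'S_m * {set 'S_m}) i := rep q.2 (q.1 i : nat).
pose psi q := ((0 < form (U q) p0)%ring, signs p0 (U q)).
pose Dom := setX [set: 'S_m] (RP0s m).
have nd q : q \in Dom -> nondegenerate (U q).
  by case: q => s S /setXP[_ /hrep[gf fi _ _]]; apply: nondegenerate_perm.
have inj : {in Dom &, injective psi}.
  move=> [s S] [s' S'] q1 q2; have [n1 n2] := (nd _ q1, nd _ q2).
  move: q1 q2 => /setXP[_ /hrep[gf fi _ eS]] /setXP[_ /hrep[gf' fi' _ eS']] [e0 es].
  have [|-> e] := @signs_determine (rep S) (rep S') s s' gf gf' fi fi'.
    apply: (form_signs n1 n2) => p ph; have [->//|pp0] := eqVneq p p0.
    have sE u : (p \in signs p0 u) = (0 < form u p)%ring by rewrite inE in_setD1 pp0 ph.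
    by rewrite -[LHS]sE -[RHS]sE; exact: (congr1 (fun A : {set _} => p \in A) es).
  by congr pair; rewrite -eS -eS'; apply/RP_nat_eqP.
have <- : #|Dom| = (m`! * r0 m)%nat by rewrite cardsX cardsT card_Sn.
rewrite -(card_in_imset inj).
apply: (@leq_trans #|[set q : bool * {set {set 'I_m} * {set 'I_m}} |
    (q.1 \in [set: bool]) && (q.2 \in sign_class p0 q.1)]|).
  apply/subset_leq_card/subsetP => _ /imsetP[q /nd nq ->].
  by rewrite !inE /=; apply/asboolP; exists (U q).
rewrite card_sigma_set (eq_bigl xpredT) => [|b]; last by rewrite inE.
by rewrite big_bool mul2n -addnn leq_add // card_sign_class.
Qed.

End SetPairs.

(** Since [t ^ d <= t ^ i] for [i <= d], this is a truncated binomial theorem; the induction uses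
    Pascal's rule summed over [i]. *)
Lemma sum_bin_le N d t : (0 <= t <= 1)%R ->
  (INR (\sum_(i < d.+1) 'C(N, i))%nat * t ^ d <= (1 + t) ^ N)%R.
Proof.
move=> t01; elim: N d => [|N IH] d.
  rewrite big_ord_recl big1 // bin0 addn0 /= Rmult_1_l.
  elim: d => [|d IH] /=; first by lra.
  have := pow_le t d; nra.
case: d => [|d].
  rewrite big_ord1 bin0; have := pow_R1_Rle (1 + t) N.+1; rewrite [(t ^ 0)%R]/=; simpl INR; lra.
have -> : (\sum_(i < d.+2) 'C(N.+1, i) = \sum_(i < d.+2) 'C(N, i) + \sum_(i < d.+1) 'C(N, i))%nat.
  rewrite big_ord_recl [in RHS]big_ord_recl !bin0 -addnA -big_split; congr (_ + _)%nat.
rewrite plus_INR; have := IH d; have := IH d.+1; rewrite -[((1 + t) ^ N.+1)%R]/((1+t) * (1+t)^N)%R.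
have et : (t ^ d.+1 = t * t ^ d)%R by [].
move=> h1 h2; rewrite et in h1 *; nra.
Qed.

Lemma exp_pow_INR t n : (exp t ^ n = exp (t * INR n))%R.
Proof.
elim: n => [|n IH]; first by rewrite Rmult_0_r exp_0.
by rewrite S_INR Rmult_plus_distr_l Rmult_1_r exp_plus -IH /= Rmult_comm.
Qed.

Lemma r0_upper k : (INR (r0 k.+4) < 2 / INR (k.+4`!) *
     (exp 1 * INR k.+4 * (INR k.+4 - 1) ^ 2 / 8) ^ k.+2)%R.
Proof.
have h := @fact_r0_le k.+4 isT.
set N := #|half_balanced k.+4|.-1 in h.
(* With [m = k+4] the right side is [(m-2) m (m-1)^2]. For [m = 4] the bound on the full half system
   is an equality, so strictness comes from leaving out one form. *)
have hN : (8 * N < k.+2 * (k.+4 * (k.+3 * k.+3)))%nat.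
  have b1 : (2 * 'C(k.+4, 2) = k.+4 * k.+3)%nat by rewrite -mul_bin_diag bin1.
  have b2 : (2 * 'C(k.+2, 2) = k.+2 * k.+1)%nat by rewrite -mul_bin_diag bin1.
  have h2 := card_half_balanced k.+4.
  rewrite card_balanced -[(k.+4.-1)%nat]/k.+3 -[(k.+4 - 2)%nat]/k.+2 in h2.
  have b12 : (4 * ('C(k.+4, 2) * 'C(k.+2, 2)) = (k.+4 * k.+3) * (k.+2 * k.+1))%nat.
    by rewrite -b1 -b2 mulnACA.
  move: ('C(k.+4, 2) * 'C(k.+2, 2))%nat #|half_balanced k.+4| @N h h2 b12 => X H /= _ h2 b12.
  lia.
have /ssrnat.ltP/lt_INR {}hN := hN; rewrite !mult_INR in hN.
have /ssrnat.leP/le_INR {}h := h.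
rewrite (mult_INR _ (r0 _)) (mult_INR 2) -[(k.+4.-1)%nat]/k.+3 in h.
have e2 : INR 2 = 2%R by rewrite /=; lra.
have e8 : INR 8 = 8%R by rewrite /=; lra.
have e3 := S_INR k.+2; have e4 := S_INR k.+3.
have k2 : (2 <= INR k.+2)%R by rewrite !S_INR; have := pos_INR k; lra.
have f0 : (0 < INR k.+4`!)%R by apply: lt_0_INR; apply/ssrnat.ltP; exact: fact_gt0.
rewrite e2 in h; rewrite e8 in hN.
move: (INR (r0 k.+4)) (INR k.+4`!) h f0 => r F h f0.
have := @sum_bin_le N k.+2; move: (INR (\sum_(i < k.+3) 'C(N, i))%nat) h => S h hS.
set M := INR k.+4 in e4 hN *; have eM : INR k.+3 = (M - 1)%R by lra.
have eM2 : INR k.+2 = (M - 2)%R by lra.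
rewrite eM eM2 in hN.
pose P := (M * ((M - 1) * (M - 1)))%R.
have P8 : (8 <= P)%R by rewrite /P; nra.
(* This makes [1 / t] equal to [m (m-1)^2 / 8] and gives [t N < m - 2], whence [S t^(m-2) <= (1+t)^N
   <= e^(t N) < e^(m-2)]. *)
pose t := (8 / P)%R.
have tP : (t * P = 8)%R by rewrite /t; field; lra.
have t01 : (0 < t <= 1)%R.
  have t0 : (0 < t)%R by apply: Rdiv_lt_0_compat; lra.
  by split=> //; nra.
have Nt : (t * INR N < INR k.+2)%R.
  by rewrite eM2; move: hN; rewrite -/P; have := pos_INR N; nra.
have lt_exp : (S * t ^ k.+2 < exp 1 ^ k.+2)%R.
  apply: (Rle_lt_trans _ ((1 + t) ^ N)%R); first by apply: hS; lra.
  apply: (Rle_lt_trans _ (exp t ^ N)%R).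
    by apply: pow_incr; have := exp_ineq1_le t; lra.
  by rewrite !exp_pow_INR Rmult_1_l; exact: exp_increasing.
have -> : (exp 1 * M * (M - 1) ^ 2 / 8 = exp 1 / t)%R.
  by rewrite /t /P; field; split; lra.
have tk : (0 < t ^ k.+2)%R by apply: pow_lt; lra.
have ltS : (S < (exp 1 / t) ^ k.+2)%R.
  rewrite /Rdiv Rpow_mult_distr pow_inv.
  by apply: (Rmult_lt_reg_r (t ^ k.+2)) => //; rewrite Rmult_assoc Rinv_l; lra.
apply: (Rmult_lt_reg_l F) => //.
have -> : (F * (2 / F * (exp 1 / t) ^ k.+2) = 2 * (exp 1 / t) ^ k.+2)%R by field; lra.
lra.
Qed.

Theorem theorem3p4 (m : nat) (hm : (4 <= m)%nat) :
  (2 * (3 / 4) ^ (m - 4) * (INR ((m - 3)`!)) ^ 2 <= INR (r0 m))%R /\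
  (INR (r0 m) < 2 / INR (m`!) *
     (exp 1 * INR m * (INR m - 1) ^ 2 / 8) ^ (m - 2))%R.
Proof.
case: m hm => [|[|[|[|k]]]] // _; split; last exact: r0_upper.
by have := r0_lower k; rewrite !subSS subn0.
Qed.
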